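(* Let $X_1$ and $X_2$ be real-valued random variables on a common probability space with $\mathrm{Var}(X_1) < \infty$ and $\mathrm{Var}(X_2) < \infty$. Let $Y := \min(X_1,X_2)$ and $Z := \max(X_1,X_2)$ (pointwise). Then $$\mathrm{Cov}(Y,Z) \ge \mathrm{Cov}(X_1,X_2),$$ with equality if and only if either $X_1 \ge X_2$ almost surely or $X_2 \ge X_1$ almost surely.
   Context: The random variables $X_1,X_2$ may be dependent and may have different distributions. Finite variance means finite second moment (square-integrable). *)

(* Defs.v *)
From mathcomp Require Import all_boot all_order all_algebra.
From mathcomp Require Import all_classical all_reals all_analysis.

(* Main.v *)
Require Import Defs.
From mathcomp Require Import all_boot all_order all_algebra.
From mathcomp Require Import all_classical all_reals all_analysis.
From mathcomp Require Import measurable_realfun ring.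

Import Order.TTheory GRing.Theory Num.Theory.
Local Open Scope classical_set_scope.
Local Open Scope ring_scope.

(** Write X1 - X2 = U - V with U = (X1 - X2)^+ and V = (X1 - X2)^-. Pointwise
    min(X1, X2) = X1 - U, max(X1, X2) = X2 + U and
    min(X1, X2) max(X1, X2) = X1 X2. The expectations of the products
    therefore cancel in the difference of the covariances, leaving
      Cov(Y, Z) - Cov(X1, X2) = E[X1] E[X2] - (E[X1] - E[U]) (E[X2] + E[U])
                              = E[U] (E[U] - E[X1] + E[X2]) = E[U] E[V]
    ([covariance_min_max]). This is a product of two nonnegative numbers, and
    it vanishes iff one factor does, that is, iff U = 0 or V = 0 almost surely
    ([expectation_funrpos_eq0]). Finite variance enters only through the
    integrability of X1, X2 and X1 X2. *)

(** The variance is the integral of the square of X - c, where the constant c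
    is the real-valued part of the expectation of X, hence 0 when that
    expectation is infinite. The argument does not depend on the value of c,
    so integrability of X need not be known beforehand. *)
Lemma variance_lty_Lfun2 {d : measure_display} {T : measurableType d}
    {R : realType} {P : probability T R} {X : {RV P >-> R}} :
  ('V_P[X] < +oo)%E -> (X : T -> R) \in Lfun P 2%:E.
Proof.
rewrite /variance !unlock.
set c := cst _ => Vlty.
have L2c : X \- c \in Lfun P 2%:E.
  have mXc : measurable_fun setT (X \- c) by exact: measurable_funB.
  rewrite inE; apply/andP; split; rewrite inE//= /finite_norm unlock /Lnorm.
  rewrite poweR_lty//; apply: le_lt_trans Vlty.
  rewrite le_eqVlt; apply/orP; left; apply/eqP.
  apply: eq_integral => w _ /=.
  by rewrite powR_mulrn// real_normK ?num_real// expr2.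
have -> : (X : T -> R) = (X \- c) \+ c by apply/funext => w /=; rewrite subrK.
by rewrite rpredD ?lee1n // => ?; exact: Lfun_cst.
Qed.

Lemma Lfun1_funrpos {d : measure_display} {T : measurableType d}
    {R : realType} {mu : {measure set T -> \bar R}} {f : T -> R} :
  f \in Lfun mu 1 -> f^\+ \in Lfun mu 1.
Proof.
move=> /Lfun1_integrable L1f; apply/Lfun1_integrable.
exact: integrable_funrpos.
Qed.

Lemma expectation_funrpos_eq0 {d : measure_display} {T : measurableType d}
    {R : realType} {P : probability T R} (f : T -> R) :
  measurable_fun setT f ->
  ('E_P[(f^\+)%R] = 0)%E <-> {ae P, forall w, f w <= 0}.
Proof.
move=> mf; rewrite unlock.
have mfp : measurable_fun setT (EFin \o f^\+).
  by apply/measurable_EFinP; exact: measurable_funrpos.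
have := ae_eq_integral_abs P measurableT mfp.
under eq_integral do rewrite /= ger0_norm ?funrpos_ge0//.
move=> [int0_ae ae_int0]; split.
- move/int0_ae; apply: filterS => w /(_ I) /= [f0].
  by rewrite -f0 /funrpos le_max lexx.
- move=> fle0; apply: ae_int0; move: fle0; apply: filterS => w fw _ /=.
  by rewrite /funrpos; move/max_idPr: fw => ->.
Qed.

Section min_max.
Context {d : measure_display} {T : measurableType d} {R : realType}.
Implicit Types X Y : T -> R.

Lemma maxr_funrpos X Y : X \max Y = Y \+ (X \- Y)^\+.
Proof.
by apply/funext => w; rewrite /= /funrpos addrC addr_maxl subrK add0r.
Qed.

Lemma minr_funrpos X Y : X \min Y = X \- (X \- Y)^\+.
Proof.
apply/funext => w; rewrite /= minr_to_max.
by move/funeqP: (maxr_funrpos X Y) => /(_ w) /= ->; ring.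
Qed.

Lemma covariance_min_max (P : probability T R) X Y :
    X \in Lfun P 1 -> Y \in Lfun P 1 -> X \* Y \in Lfun P 1 ->
  (covariance P (X \min Y) (X \max Y) =
   covariance P X Y + 'E_P[((X \- Y)^\+)%R] * 'E_P[((X \- Y)^\-)%R])%E.
Proof.
move=> L1X L1Y L1XY.
have L1D : X \- Y \in Lfun P 1 by rewrite rpredB.
have L1U := Lfun1_funrpos L1D.
have L1V : (X \- Y)^\- \in Lfun P 1.
  by rewrite -funrposN; apply: Lfun1_funrpos; rewrite rpredN.
have prodE : (X \min Y) * (X \max Y) = X * Y.
  apply/funext => w; rewrite !fctE /=.
  by case: (leP (X w) (Y w)) => // _; rewrite mulrC.
have EV : ('E_P[((X \- Y)^\-)%R] =
  'E_P[((X \- Y)^\+)%R] - ('E_P[X] - 'E_P[Y]))%E.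
  rewrite -expectationB// -expectationB//; congr ('E_P[_])%E.
  by rewrite -[X in _ = _ \- X]funrposBneg; apply/funext => w /=; rewrite subKr.
rewrite !covarianceE ?prodE//; last 2 first.
- by rewrite minr_funrpos rpredB.
- by rewrite maxr_funrpos rpredD.
rewrite EV minr_funrpos maxr_funrpos expectationB// expectationD//.
move: (expectation_fin_num L1X) (expectation_fin_num L1Y)
  (expectation_fin_num L1U) (expectation_fin_num L1XY).
move=> /fineK <- /fineK <- /fineK <- /fineK <-.
by rewrite -!(EFinM, EFinB, EFinD); congr EFin; ring.
Qed.

End min_max.

Theorem theorem1 (d : measure_display) (T : measurableType d) (R : realType)
    (P : probability T R) (X1 X2 : {RV P >-> R})
    (varX1 : ('V_P[X1] < +oo)%E) (varX2 : ('V_P[X2] < +oo)%E) :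
  let Y : T -> R := X1 \min X2 in
  let Z : T -> R := X1 \max X2 in
  (covariance P Y Z >= covariance P X1 X2)%E /\
  (covariance P Y Z = covariance P X1 X2 <->
     ({ae P, forall w, X1 w >= X2 w} \/ {ae P, forall w, X2 w >= X1 w})).
Proof.
have L2X1 := variance_lty_Lfun2 varX1; have L2X2 := variance_lty_Lfun2 varX2.
have Pfin : P setT \is a fin_num by exact: fin_num_measure.
have L1X1 : (X1 : T -> R) \in Lfun P 1 by exact: Lfun_subset12 L2X1.
have L1X2 : (X2 : T -> R) \in Lfun P 1 by exact: Lfun_subset12 L2X2.
have L1X12 := Lfun2_mul_Lfun1 L2X1 L2X2.
have mD : measurable_fun setT (X1 \- X2) by exact: measurable_funB.
have posP : ('E_P[((X1 \- X2)^\+)%R] = 0)%E <-> {ae P, forall w, X2 w >= X1 w}.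
  rewrite expectation_funrpos_eq0//.
  by split; apply: filterS => w /=; rewrite subr_le0.
have negP : ('E_P[((X1 \- X2)^\-)%R] = 0)%E <-> {ae P, forall w, X1 w >= X2 w}.
  rewrite -funrposN expectation_funrpos_eq0; last exact: measurableT_comp.
  by split; apply: filterS => w /=; rewrite opprB subr_le0.
move=> Y Z; rewrite covariance_min_max//; split.
  by rewrite leeDl// mule_ge0// expectation_ge0.
have covfin := covariance_fin_num L1X1 L1X2 L1X12.
rewrite -posP -negP; split.
  rewrite addeC => /(congr1 (fun t => t - covariance P X1 X2)%E).
  rewrite addeK// subee// => /eqP.
  by rewrite mule_eq0 => /orP[]/eqP; [right|left].
by case=> ->; rewrite ?mul0e ?mule0 adde0.
Qed.
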